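(* Let $(u_1, u_2, u_3, u_4)$ be a Büchi quadruple. Then there exist non-negative integers $s_0, s_1, \dots, s_{15}$, $\beta_1, \beta_2 \in \{1,2\}$, and $\delta \in \{1,3\}$ satisfying the relations \[ s_8 = \frac{(3/\delta) s_4 s_{11} - s_1 s_{14}}{\beta_1 (2/\beta_2) s_7}, \qquad s_{13} = \frac{s_4 s_{11} + \delta s_1 s_{14}}{\beta_1 (2/\beta_2) s_2},\] \[ s_3 = \frac{(s_1 s_{14} + (3/\delta) s_4 s_{11}) s_9 - 2 s_4 s_{14} s_{12}}{2 s_2 s_7}, \qquad s_6 = \frac{2 s_1 s_{11} s_9 - (\delta s_1 s_{14} - s_4 s_{11}) s_{12}}{2 s_2 s_7},\] \[ s_0 = \frac{s_9 s_{11} - \delta s_{12} s_{14}}{\beta_1 s_2}, \qquad s_5 = \frac{(3/\delta) s_9 s_{11} - s_{12} s_{14}}{\beta_1 s_7},\] \[ s_{10} = \frac{s_1 s_9 + s_4 s_{12}}{\beta_1 s_2}, \qquad s_{15} = \frac{-s_1 s_9 + s_4 s_{12}}{\beta_1 s_7},\] such that, with \[ x_1 = s_0 s_2 s_4 s_6 s_8 s_{10} s_{12} s_{14}, \quad y_1 = s_1 s_3 s_5 s_7 s_9 s_{11} s_{13} s_{15},\] \[ x_2 = s_0 s_1 s_4 s_5 s_8 s_9 s_{12} s_{13}, \quad y_2 = s_2 s_3 s_6 s_7 s_{10} s_{11} s_{14} s_{15},\] \[ x_3 = s_0 s_1 s_2 s_3 s_8 s_9 s_{10} s_{11}, \quad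 y_3 = s_4 s_5 s_6 s_7 s_{12} s_{13} s_{14} s_{15},\] \[ x_4 = s_0 s_1 s_2 s_3 s_4 s_5 s_6 s_7, \quad y_4 = s_8 s_9 s_{10} s_{11} s_{12} s_{13} s_{14} s_{15},\] one has $u_k = x_k - y_k$ for $k = 1,2,3,4$.
   Context: A Büchi $n$-tuple is an $n$-tuple $(u_1, \dots, u_n)$ of positive integers such that $u_1^2, \dots, u_n^2$ is an increasing sequence of squares with second difference equal to $2$, i.e. $u_{k+2}^2 - 2u_{k+1}^2 + u_k^2 = 2$ for $1 \le k \le n-2$. A Büchi quadruple is a Büchi $4$-tuple. *)

(* Defs.v *)
From mathcomp Require Import all_boot all_order all_algebra.

Set Implicit Arguments.
Unset Strict Implicit.
Unset Printing Implicit Defensive.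

Import GRing.Theory.
Local Open Scope ring_scope.

(* The entry u_(k+1) of the usual 1-based notation is nth 0 u k. *)
Definition buchi_tuple (n : nat) (u : n.-tuple nat) : Prop :=
  let sq k : int := (nth 0%N u k)%:Z ^+ 2 in
  [/\ forall k, (k < n)%N -> (0 < nth 0%N u k)%N,
      forall k, (k.+1 < n)%N -> sq k < sq k.+1
    & forall k, (k.+2 < n)%N -> sq k.+2 - 2 * sq k.+1 + sq k = 2].

(* The fractions are taken in rat, where x / 0 = 0, so the nonvanishing of the
   denominators that they presuppose is stated separately. *)
Definition buchi_relations
    (s0 s1 s2 s3 s4 s5 s6 s7 s8 s9 s10 s11 s12 s13 s14 s15 : rat)
    (beta1 beta2 delta : rat) : Prop :=
  (s2 != 0 /\ s7 != 0) /\
  [/\ s8 = (3 / delta * s4 * s11 - s1 * s14)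
            / (beta1 * (2 / beta2) * s7),
      s13 = (s4 * s11 + delta * s1 * s14)
             / (beta1 * (2 / beta2) * s2),
      s3 = ((s1 * s14 + 3 / delta * s4 * s11) * s9
             - 2 * s4 * s14 * s12) / (2 * s2 * s7)
    & s6 = (2 * s1 * s11 * s9
             - (delta * s1 * s14 - s4 * s11) * s12) / (2 * s2 * s7)] /\
  [/\ s0 = (s9 * s11 - delta * s12 * s14) / (beta1 * s2),
      s5 = (3 / delta * s9 * s11 - s12 * s14) / (beta1 * s7),
      s10 = (s1 * s9 + s4 * s12) / (beta1 * s2)
    & s15 = (- (s1 * s9) + s4 * s12) / (beta1 * s7)].

(* Main.v *)
Require Import Defs.
From mathcomp Require Import all_boot all_order all_algebra.
From mathcomp Require Import zify ring lra.

(* Let s = (u2^2 - u1^2 - 1)/2. Then (s + k - 1)^2 - u_k^2 does not depend on k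
   and equals 4P, so x_k = (s + k - 1 + u_k)/2 and y_k = (s + k - 1 - u_k)/2
   satisfy x_k y_k = P and x_k + y_k = s + k - 1.
   For i > j, a common refinement x_i = A B, y_i = C D, x_j = A C, y_j = B D gives
   (A - D)(B - C) = i - j with both factors positive. Refining all four
   factorizations of P at once produces the s_i, and the twelve differences
   A - D, B - C are 2x2 minors in products of the s_i: each is 1 for consecutive
   indices, while the others multiply to 2, 2 and 3. The relations follow from
   three-term Pluecker identities between these minors. They also require
   A - D to agree for the pairs (3,1) and (4,2); a factor 2 can be moved between
   {A, D} and {B, C} in whichever of the two pairs has even entries. *)

Set Implicit Arguments.
Unset Strict Implicit.

Import GRing.Theory Num.Theory.

(** * Common refinements of equal products *)

(** Taking [p] to be the gcd of [x] and [z] leaves coprime cofactors [q], [r] with [q * y = r * w],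
    so [q] divides [w]. *)
Lemma four_number (x y z w : nat) : 0 < x -> x * y = z * w ->
  exists p q r s, [/\ x = p * q, y = r * s, z = p * r & w = q * s].
Proof.
move=> x0 e; have g0 : 0 < gcdn x z by rewrite gcdn_gt0 x0.
have /dvdnP [q xq] := dvdn_gcdl x z; have /dvdnP [r zr] := dvdn_gcdr x z.
have cqr : coprime q r.
  rewrite /coprime -(eqn_pmul2r g0) muln_gcdl -xq -zr mul1n //.
have eqr : q * y = r * w.
  apply/eqP; rewrite -(eqn_pmul2r g0); apply/eqP.
  by rewrite mulnAC -xq e {1}zr mulnAC.
have /dvdnP [s ws] : q %| w by rewrite -(Gauss_dvdr _ cqr) -eqr dvdn_mulr.
have q0 : 0 < q by move: x0; rewrite xq muln_gt0 => /andP [].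
exists (gcdn x z), q, r, s; split; rewrite 1?mulnC //.
by apply/eqP; rewrite -(eqn_pmul2l q0) eqr ws; apply/eqP; ring.
Qed.

(** The [s_i] fill a 4 by 4 table, row by row, with row products [a, b, c, d] and column products
    [a', b', c', d']. One use of [four_number] gives the products of its 2 by 2 blocks, four uses
    split these along rows and columns, and four more fill the blocks. *)
Lemma four_refinement (a b c d a' b' c' d' : nat) :
  0 < a * b * (c * d) -> a * b * (c * d) = a' * b' * (c' * d') ->
  exists s0 s1 s2 s3 s4 s5 s6 s7 s8 s9 s10 s11 s12 s13 s14 s15,
    [/\ [/\ a = s0 * s1 * s2 * s3, b = s4 * s5 * s6 * s7,
            c = s8 * s9 * s10 * s11 & d = s12 * s13 * s14 * s15]
      & [/\ a' = s0 * s4 * s8 * s12, b' = s1 * s5 * s9 * s13,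
            c' = s2 * s6 * s10 * s14 & d' = s3 * s7 * s11 * s15]].
Proof.
rewrite !muln_gt0 => /andP [/andP [a0 b0] /andP [c0 d0]] e.
have ab0 : 0 < a * b by rewrite muln_gt0 a0.
have a'b'0 : 0 < a' * b' * (c' * d') by rewrite -e !muln_gt0 a0 b0 c0.
move: a'b'0; rewrite !muln_gt0 => /andP [/andP [a'0 _] /andP [c'0 _]].
have [p [q [r [s [epq ers epr eqs]]]]] := four_number ab0 e.
have [ap [aq [bp [bq [ea eb ep eq]]]]] := four_number a0 epq.
have [cr [cs [dr [ds [ec ed er es]]]]] := four_number c0 ers.
have [a'p [a'r [b'p [b'r [ea' eb' ep' er']]]]] := four_number a'0 epr.
have [c'q [c's [d'q [d's [ec' ed' eq' es']]]]] := four_number c'0 eqs.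
move: a0 c0; rewrite ea ec !muln_gt0 => /andP [ap0 aq0] /andP [cr0 cs0].
have [s0 [s1 [s4 [s5 [? ? ? ?]]]]] :=
  four_number ap0 (etrans (esym ep) ep').
have [s2 [s3 [s6 [s7 [? ? ? ?]]]]] :=
  four_number aq0 (etrans (esym eq) eq').
have [s8 [s9 [s12 [s13 [? ? ? ?]]]]] :=
  four_number cr0 (etrans (esym er) er').
have [s10 [s11 [s14 [s15 [? ? ? ?]]]]] :=
  four_number cs0 (etrans (esym es) es').
exists s0, s1, s2, s3, s4, s5, s6, s7, s8, s9, s10, s11, s12, s13, s14, s15.
by split; split; subst; ring.
Qed.

(** * Crossings of two factorizations of one product *)

(** Since [a * b + c * d - a * c - b * d = (a - d) * (b - c)], it only remains to fix signs, which
    the two inequalities do. *)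
Lemma same_product_crossing (a b c d k : nat) :
  c * d < a * b -> b * d < a * c -> a * b + c * d = a * c + b * d + k ->
  exists d1 d2, [/\ a = d + d1, b = c + d2 & d1 * d2 = k].
Proof.
(* If [a <= d], then [a * c <= d * c < a * b <= d * b < a * c]. *)
move=> h1 h2 h3; have [ad|da] := leqP a d.
  by have := leq_mul ad (leqnn b); have := leq_mul ad (leqnn c); lia.
have {da} ea := subnKC (ltnW da); move: (a - d) ea => e ea; subst a.
have e0 : 0 < e by case: e h1 h2 {h3} => //; lia.
have eb : e * b = e * c + k by lia.
have cb : c <= b by rewrite -(leq_pmul2l e0) eb leq_addr.
exists e, (b - c); rewrite subnKC //; split=> //.
by rewrite mulnBr eb addKn.
Qed.

Lemma crossing_gap2 (a b c d : nat) :
  d * b < a * c -> c * d < a * b ->  a * b + c * d = a * c + b * d + 2 ->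
  a = d + 1 /\ b = c + 2 \/ a = d + 2 /\ b = c + 1.
Proof.
rewrite [d * b]mulnC => h1 h2 h3.
have [d1 [d2 [-> -> e]]] := same_product_crossing h2 h1 h3.
have : d1 <= 2 by apply: dvdn_leq => //; rewrite -e dvdn_mulr.
by case: d1 e => [|[|[|]]] //; case: d2 => [|[|[|]]] //; auto; lia.
Qed.

(** The gaps [t] and [t'] are parameters so that the crossings of two index pairs can be required to
    have the same ones. *)
Definition crossing (x1 y1 x3 y3 t t' : nat) : Prop :=
  exists a b c d,
    [/\ x3 = a * b, y3 = c * d, x1 = a * c & y1 = b * d] /\
    (a = d + t /\ b = c + t').

Lemma gap2_crossing (x1 y1 x3 y3 : nat) :
  y1 < x1 -> y3 < x3 -> x1 * y1 = x3 * y3 -> x3 + y3 = x1 + y1 + 2 ->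
  crossing x1 y1 x3 y3 1 2 \/ crossing x1 y1 x3 y3 2 1.
Proof.
move=> l1 l3 ep es; have x30 : 0 < x3 by case: x3 l3 {ep es}.
have [a [b [c [d [e1 e2 e3 e4]]]]] := four_number x30 (esym ep).
rewrite e1 e2 e3 e4 [b * d]mulnC in l1 l3 es.
have h : a * b + c * d = a * c + b * d + 2 by rewrite es [d * b]mulnC.
by have [gap|gap] := crossing_gap2 l1 l3 h; [left|right]; exists a, b, c, d.
Qed.

(** With gaps 1 and 2, [x1 + y1 = 2 * c * d + c + 2 * d], so [c] and [b = c + 2] are even and
    [(2a, b/2, c/2, 2d)] is a crossing with the gaps exchanged. With gaps 2 and 1, [d] and [a] are
    even instead. *)
Lemma even_gap2_crossing (x1 y1 x3 y3 : nat) :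
  y1 < x1 -> y3 < x3 -> x1 * y1 = x3 * y3 -> x3 + y3 = x1 + y1 + 2 ->
  ~~ odd (x1 + y1) ->
  crossing x1 y1 x3 y3 1 2 /\ crossing x1 y1 x3 y3 2 1.
Proof.
move=> l1 l3 ep es ev; have ev2 n : ~~ odd n -> exists m, n = 2 * m.
  by move=> on; exists n./2; rewrite mul2n even_halfK.
have [cr|cr] := gap2_crossing l1 l3 ep es; split=> //.
- have [a [b [c [d [[e1 e2 e3 e4] [ad bc]]]]]] := cr.
  have [c' ec] : exists c', c = 2 * c'.
    apply: ev2; move: ev; rewrite e3 e4 ad bc.
    by rewrite !(oddD, oddM) /=; case: (odd c); case: (odd d).
  exists (2 * a), (c' + 1), c', (2 * d); subst.
  by split; [split|split]; ring.
- have [a [b [c [d [[e1 e2 e3 e4] [ad bc]]]]]] := cr.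
  have [d' ed] : exists d', d = 2 * d'.
    apply: ev2; move: ev; rewrite e3 e4 ad bc.
    by rewrite !(oddD, oddM) /=; case: (odd c); case: (odd d).
  exists (d' + 1), (2 * b), (2 * c), d'; subst.
  by split; [split|split]; ring.
Qed.

(** One of the consecutive sums [x1 + y1], [x2 + y2] is even; that pair admits both kinds of
    crossing and adapts to the other pair. *)
Lemma matching_crossings (x1 y1 x2 y2 x3 y3 x4 y4 : nat) :
  y1 < x1 -> y2 < x2 -> y3 < x3 -> y4 < x4 ->
  x1 * y1 = x3 * y3 -> x2 * y2 = x4 * y4 ->
  x2 + y2 = x1 + y1 + 1 -> x3 + y3 = x2 + y2 + 1 -> x4 + y4 = x3 + y3 + 1 ->
  exists t t' : nat, [/\ t = 1 /\ t' = 2 \/ t = 2 /\ t' = 1,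
    crossing x1 y1 x3 y3 t t' & crossing x2 y2 x4 y4 t t'].
Proof.
move=> l1 l2 l3 l4 e13 e24 s21 s32 s43.
have s31 : x3 + y3 = x1 + y1 + 2 by lia.
have s42 : x4 + y4 = x2 + y2 + 2 by lia.
have [odd1|even1] := boolP (odd (x1 + y1)).
  have even2 : ~~ odd (x2 + y2) by rewrite s21 oddD odd1.
  have [cr1 cr2] := even_gap2_crossing l2 l4 e24 s42 even2.
  by have [cr|cr] := gap2_crossing l1 l3 e13 s31; [exists 1, 2|exists 2, 1];
    split; auto.
have [cr1 cr2] := even_gap2_crossing l1 l3 e13 s31 even1.
by have [cr|cr] := gap2_crossing l2 l4 e24 s42; [exists 1, 2|exists 2, 1];
  split; auto.
Qed.

(** * Three-term Pluecker identities and the required relations *)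

Local Open Scope ring_scope.

(** This expands the zero determinant with rows [x], [x], [y] along its first row. *)
Lemma plucker3 (R : comNzRingType) (x1 y1 x2 y2 x3 y3 d12 d13 d23 : R) :
  x1 * y2 - x2 * y1 = d12 -> x1 * y3 - x3 * y1 = d13 ->
  x2 * y3 - x3 * y2 = d23 -> d23 * x1 + d12 * x3 = d13 * x2.
Proof. by move=> <- <- <-; ring. Qed.

(* b, c, f and g play the roles of beta1, 2 / beta2, delta and 3 / delta, so that
   b * c = 2 means beta2 = beta1. *)
Lemma buchi_relations_of_minors
    (s0 s1 s2 s3 s4 s5 s6 s7 s8 s9 s10 s11 s12 s13 s14 s15 b c f g : rat) :
  s2 != 0 -> s7 != 0 -> s9 != 0 -> b * c = 2 -> f * g = 3 ->
  s0 * s4 * s8 * s12 - s3 * s7 * s11 * s15 = 1 ->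
  s1 * s5 * s9 * s13 - s2 * s6 * s10 * s14 = 1 ->
  s0 * s1 * s8 * s9 - s6 * s7 * s14 * s15 = 1 ->
  s2 * s3 * s10 * s11 - s4 * s5 * s12 * s13 = 1 ->
  s0 * s1 * s2 * s3 - s12 * s13 * s14 * s15 = 1 ->
  s4 * s5 * s6 * s7 - s8 * s9 * s10 * s11 = 1 ->
  s1 * s3 * s9 * s11 - s4 * s6 * s12 * s14 = b ->
  s0 * s1 * s4 * s5 - s10 * s11 * s14 * s15 = c ->
  s0 * s2 * s4 * s6 - s9 * s11 * s13 * s15 = f ->
  s1 * s3 * s5 * s7 - s8 * s10 * s12 * s14 = g ->
  buchi_relations s0 s1 s2 s3 s4 s5 s6 s7 s8 s9 s10 s11 s12 s13 s14 s15 b b f.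
Proof.
move=> s2n0 s7n0 s9n0 bc fg e21 e21' e32 e32' e43 e43' e31' e42 e41 e41'.
have bn0 : b != 0 by apply/eqP => b0; move: bc; rewrite b0 mul0r.
have fn0 : f != 0 by apply/eqP => f0; move: fg; rewrite f0 mul0r.
(* In each of the eight identities the given [y] entries make the three minors equal, up to sign, to
   assumed ones. *)
have r10 : b * (s2 * s10) + -1 * (s4 * s12) = 1 * (s1 * s9).
  by apply: (@plucker3 _ _ (s5 * s13) _ (s6 * s14) _ (s3 * s11)); lra.
have r15 : - b * (s7 * s15) + -1 * (s1 * s9) = -1 * (s4 * s12).
  by apply: (@plucker3 _ _ (s0 * s8) _ (s3 * s11) _ (s6 * s14)); lra.
have r0 : b * (s0 * s2) + f * (s12 * s14) = 1 * (s9 * s11).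
  by apply: (@plucker3 _ _ (s13 * s15) _ (s4 * s6) _ (s1 * s3)); lra.
have r5 : b * (s5 * s7) + 1 * (s12 * s14) = g * (s9 * s11).
  by apply: (@plucker3 _ _ (s8 * s10) _ (s4 * s6) _ (s1 * s3)); lra.
have r89 : -1 * (s4 * s5) + c * (s8 * s9) = 1 * (s14 * s15).
  by apply: (@plucker3 _ _ (s10 * s11) _ (s0 * s1) _ (s6 * s7)); lra.
have r23 : -1 * (s4 * s5) + c * (s2 * s3) = -1 * (s14 * s15).
  by apply: (@plucker3 _ _ (s10 * s11) _ (s0 * s1) _ (s12 * s13)); lra.
have r67 : 1 * (s10 * s11) + - c * (s6 * s7) = -1 * (s0 * s1).
  by apply: (@plucker3 _ _ (s4 * s5) _ (s14 * s15) _ (s8 * s9)); lra.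
have r913 : -1 * (s0 * s4) + c * (s9 * s13) = f * (s10 * s14).
  by apply: (@plucker3 _ _ (s11 * s15) _ (s1 * s5) _ (s2 * s6)); lra.
rewrite /buchi_relations.
have -> : b * (2 / b) = 2 :> rat by rewrite mulrC divfK.
have -> : 3 / f = g by rewrite -fg mulrC mulKf.
have two_n0 : (2 : rat) != 0 by [].
split; first by [].
split; split.
- apply: (canRL (mulfK _)); first by rewrite !mulf_neq0.
  (* The factor [s9] allows [r5] and [r15] to replace [s9 * s11] and [s1 * s9]; the terms in
     [s4 * s12 * s14] cancel, and [r89] with [b * c = 2] finishes. *)
  apply: (mulIf s9n0).
  have h1 := congr1 ( *%R s4) r5; have h2 := congr1 ( *%R s14) r15.
  have h3 := congr1 ( *%R (b * s7)) r89.
  have h4 := congr1 ( *%R (s7 * s8 * s9)) bc.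
  by lra.
- apply: (canRL (mulfK _)); first by rewrite !mulf_neq0.
  apply: (mulIf s9n0).
  have h1 := congr1 ( *%R s4) r0; have h2 := congr1 ( *%R (f * s14)) r10.
  have h3 := congr1 ( *%R (b * s2)) r913; have h4 := congr1 ( *%R (s2 * s9 * s13)) bc.
  by lra.
- apply: (canRL (mulfK _)); first by rewrite !mulf_neq0.
  have h1 := congr1 ( *%R s4) r5; have h2 := congr1 ( *%R s14) r15.
  have h3 := congr1 ( *%R (b * s7)) r23; have h4 := congr1 ( *%R (s2 * s3 * s7)) bc.
  by lra.
- apply: (canRL (mulfK _)); first by rewrite !mulf_neq0.
  have h1 := congr1 ( *%R s1) r0; have h2 := congr1 ( *%R s11) r10.
  have h3 := congr1 ( *%R (b * s2)) r67; have h4 := congr1 ( *%R (s2 * s6 * s7)) bc.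
  by lra.
- by apply: (canRL (mulfK _)); [rewrite !mulf_neq0 | lra].
- by apply: (canRL (mulfK _)); [rewrite !mulf_neq0 | lra].
- by apply: (canRL (mulfK _)); [rewrite !mulf_neq0 | lra].
- by apply: (canRL (mulfK _)); [rewrite !mulf_neq0 | lra].
Qed.

(** * Minors of four factorizations of one number *)

Lemma crossing_minors (R : pzRingType) (a b c d x1 y1 x3 y3 k : nat) :
  (y1 < x1)%N -> (y3 < x3)%N -> (x3 + y3 = x1 + y1 + k)%N ->
  x3 = (a * b)%N -> y3 = (c * d)%N -> x1 = (a * c)%N -> y1 = (b * d)%N ->
  exists d1 d2, [/\ a%:R - d%:R = d1%:R :> R, b%:R - c%:R = d2%:R :> R
                 & (d1 * d2 = k)%N].
Proof.
move=> l1 l3 s E1 E2 E3 E4; rewrite E1 E2 in l3 s; rewrite E3 E4 in l1 s.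
have [d1 [d2 [-> -> <-]]] := same_product_crossing l3 l1 s.
by exists d1, d2; rewrite !natrD [d%:R + _]addrC [c%:R + _]addrC !addrK.
Qed.

Lemma crossing_minors1 (R : pzRingType) (a b c d x1 y1 x3 y3 : nat) :
  (y1 < x1)%N -> (y3 < x3)%N -> (x3 + y3 = x1 + y1 + 1)%N ->
  x3 = (a * b)%N -> y3 = (c * d)%N -> x1 = (a * c)%N -> y1 = (b * d)%N ->
  a%:R - d%:R = 1 :> R /\ b%:R - c%:R = 1 :> R.
Proof.
move=> l1 l3 s E1 E2 E3 E4.
have [d1 [d2 [-> -> /eqP]]] := crossing_minors R l1 l3 s E1 E2 E3 E4.
by rewrite muln_eq1 => /andP[/eqP-> /eqP->].
Qed.

Lemma common_factorization (x1 y1 x2 y2 x3 y3 x4 y4 : nat) :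
  (0 < y1 < x1)%N -> (0 < y2 < x2)%N -> (0 < y3 < x3)%N -> (0 < y4 < x4)%N ->
  (x2 * y2 = x1 * y1)%N -> (x3 * y3 = x1 * y1)%N -> (x4 * y4 = x1 * y1)%N ->
  (x2 + y2 = x1 + y1 + 1)%N -> (x3 + y3 = x2 + y2 + 1)%N ->
  (x4 + y4 = x3 + y3 + 1)%N ->
  exists (s0 s1 s2 s3 s4 s5 s6 s7 s8 s9 s10 s11 s12 s13 s14 s15 : nat)
         (beta1 beta2 delta : nat),
    [/\ beta1 = 1%N \/ beta1 = 2%N,
        beta2 = 1%N \/ beta2 = 2%N,
        delta = 1%N \/ delta = 3%N
      & buchi_relations
          s0%:R s1%:R s2%:R s3%:R s4%:R s5%:R s6%:R s7%:R
          s8%:R s9%:R s10%:R s11%:R s12%:R s13%:R s14%:R s15%:R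
          beta1%:R beta2%:R delta%:R] /\
    [/\ x1 = (s0 * s2 * s4 * s6 * s8 * s10 * s12 * s14)%N /\
        y1 = (s1 * s3 * s5 * s7 * s9 * s11 * s13 * s15)%N,
        x2 = (s0 * s1 * s4 * s5 * s8 * s9 * s12 * s13)%N /\
        y2 = (s2 * s3 * s6 * s7 * s10 * s11 * s14 * s15)%N,
        x3 = (s0 * s1 * s2 * s3 * s8 * s9 * s10 * s11)%N /\
        y3 = (s4 * s5 * s6 * s7 * s12 * s13 * s14 * s15)%N
      & x4 = (s0 * s1 * s2 * s3 * s4 * s5 * s6 * s7)%N /\
        y4 = (s8 * s9 * s10 * s11 * s12 * s13 * s14 * s15)%N].
Proof.
move=> /andP[p1 l1] /andP[p2 l2] /andP[p3 l3] /andP[p4 l4] e2 e3 e4 s21 s32 s43.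
have [t [t' [tt' cr13 cr24]]] :=
  matching_crossings l1 l2 l3 l4 (esym e3) (etrans e2 (esym e4)) s21 s32 s43.
have [a [b [c [d [[ex3 ey3 ex1 ey1] [ad bc]]]]]] := cr13.
have [a' [b' [c' [d' [[ex4 ey4 ex2 ey2] [ad' bc']]]]]] := cr24.
have P0 : (0 < a * b * (c * d))%N.
  by rewrite -ex3 -ey3 muln_gt0 p3 (leq_ltn_trans _ l3).
have eP : (a * b * (c * d) = a' * b' * (c' * d'))%N.
  by rewrite -ex3 -ey3 -ex4 -ey4 e3 e4.
(* The names are permuted so that [s_i] divides [x_k] when the binary digit of [i] of weight
   [2^(k-1)] is 0, and [y_k] when it is 1. *)
have [s0 [s2 [s8 [s10 [s1 [s3 [s9 [s11 [s4 [s6 [s12 [s14 [s5 [s7 [s13 [s15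
  [[ea eb ec ed] [ea' eb' ec' ed']]]]]]]]]]]]]]]]]] := four_refinement P0 eP.
have x1E : x1 = (s0 * s2 * s4 * s6 * s8 * s10 * s12 * s14)%N.
  by rewrite ex1 ea ec; ring.
have y1E : y1 = (s1 * s3 * s5 * s7 * s9 * s11 * s13 * s15)%N.
  by rewrite ey1 eb ed; ring.
have x2E : x2 = (s0 * s1 * s4 * s5 * s8 * s9 * s12 * s13)%N.
  by rewrite ex2 ea' ec'; ring.
have y2E : y2 = (s2 * s3 * s6 * s7 * s10 * s11 * s14 * s15)%N.
  by rewrite ey2 eb' ed'; ring.
have x3E : x3 = (s0 * s1 * s2 * s3 * s8 * s9 * s10 * s11)%N.
  by rewrite ex3 ea eb; ring.
have y3E : y3 = (s4 * s5 * s6 * s7 * s12 * s13 * s14 * s15)%N.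
  by rewrite ey3 ec ed; ring.
have x4E : x4 = (s0 * s1 * s2 * s3 * s4 * s5 * s6 * s7)%N.
  by rewrite ex4 ea' eb'; ring.
have y4E : y4 = (s8 * s9 * s10 * s11 * s12 * s13 * s14 * s15)%N.
  by rewrite ey4 ec' ed'; ring.
have s41 : (x4 + y4 = x1 + y1 + 3)%N by lia.
have e43 := @crossing_minors1 rat (s0 * s1 * s2 * s3) (s4 * s5 * s6 * s7)
  (s8 * s9 * s10 * s11) (s12 * s13 * s14 * s15) _ _ _ _ l3 l4 s43.
have e32 := @crossing_minors1 rat (s0 * s1 * s8 * s9) (s2 * s3 * s10 * s11)
  (s4 * s5 * s12 * s13) (s6 * s7 * s14 * s15) _ _ _ _ l2 l3 s32.
have e21 := @crossing_minors1 rat (s0 * s4 * s8 * s12) (s1 * s5 * s9 * s13)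
  (s2 * s6 * s10 * s14) (s3 * s7 * s11 * s15) _ _ _ _ l1 l2 s21.
have e41 := @crossing_minors rat (s0 * s2 * s4 * s6) (s1 * s3 * s5 * s7)
  (s8 * s10 * s12 * s14) (s9 * s11 * s13 * s15) _ _ _ _ _ l1 l4 s41.
have [||||e43a e43b] := e43; [rewrite ?x3E ?x4E ?y3E ?y4E; ring .. | ].
have [||||e32a e32b] := e32; [rewrite ?x2E ?x3E ?y2E ?y3E; ring .. | ].
have [||||e21a e21b] := e21; [rewrite ?x1E ?x2E ?y1E ?y2E; ring .. | ].
have [||||f [g [e41a e41b fg]]] := e41; [rewrite ?x1E ?x4E ?y1E ?y4E; ring .. | ].
have e31 : b%:R - c%:R = t'%:R :> rat by rewrite bc natrD addrC addKr.
have e42 : a'%:R - d'%:R = t%:R :> rat by rewrite ad' natrD addrC addKr.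
rewrite eb ec in e31; rewrite ea' ed' in e42.
have t'12 : t' = 1%N \/ t' = 2%N by case: tt' => [[_ ->]|[_ ->]]; auto.
(* The minors for indices 4 and 1 satisfy [f * g = 3]; [f] will be [delta]. *)
have f13 : f = 1%N \/ f = 3%N.
  have : (f <= 3)%N by apply: dvdn_leq => //; rewrite -fg dvdn_mulr.
  by case: f fg {e41a} => [|[|[|[|]]]] //; auto; lia.
(* Every [s_i] is a factor of the positive number [x3 * y3]. *)
have [s2n0 s7n0 s9n0] :
    [/\ s2%:R != 0 :> rat, s7%:R != 0 :> rat & s9%:R != 0 :> rat].
  have : (0 < x3 * y3)%N by rewrite muln_gt0 p3 (leq_ltn_trans _ l3).
  rewrite x3E y3E !muln_gt0 !pnatr_eq0 -!lt0n => pos.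
  by split; move: pos; do ![case/andP | move=> ?].
exists s0, s1, s2, s3, s4, s5, s6, s7, s8, s9, s10, s11, s12, s13, s14, s15.
(* As [t * t' = 2], the choice [beta2 = t'] makes [2 / beta2] the minor [t] of the pair (4,2). *)
exists t', t', f; split; last by [].
split=> //; rewrite !natrM in e21a e21b e32a e32b e43a e43b e31 e42 e41a e41b.
apply: (@buchi_relations_of_minors _ _ _ _ _ _ _ _ _ _ _ _ _ _ _ _
          t'%:R t%:R f%:R g%:R) => //.
- by case: tt' => [[-> ->]|[-> ->]].
- by rewrite -natrM fg.
Qed.

(** * From a Büchi quadruple to four factorizations *)

(** Here [y = (t - u) / 2], an integer because [t] and [u] have equal parity, and
    [(u + y) * y = (t^2 - u^2) / 4]. *)
Lemma factors_of_square_gap4 (u t p : nat) : (t ^ 2 = u ^ 2 + 4 * p)%N ->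
  exists2 y, t = (u + y + y)%N & ((u + y) * y = p)%N.
Proof.
move=> e; have ut : (u <= t)%N by rewrite -leq_sqr e leq_addr.
have {ut} et := subnKC ut; move: (t - u)%N et => d et; subst t.
have ev : ~~ odd d.
  move/(congr1 odd): e; rewrite oddX oddD (oddD (u ^ 2)) oddX oddM /=.
  by case: (odd u); case: (odd d).
exists d./2; first by rewrite -addnA addnn even_halfK.
have ed : d = (d./2 + d./2)%N by rewrite addnn even_halfK.
move: (d./2) ed e => h ->; rewrite !expnS !expn0; lia.
Qed.

Lemma buchi_quadruple_factors (u1 u2 u3 u4 : nat) :
  buchi_tuple [tuple u1; u2; u3; u4] ->
  exists s p : nat,
    [/\ (s ^ 2 = u1 ^ 2 + 4 * p)%N, (s.+1 ^ 2 = u2 ^ 2 + 4 * p)%N,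
        (s.+2 ^ 2 = u3 ^ 2 + 4 * p)%N & (s.+3 ^ 2 = u4 ^ 2 + 4 * p)%N].
Proof.
case=> _ inc sq; have {inc} := inc 0%N isT.
have /= := sq 0%N isT; have /= {sq} := sq 1%N isT.
move=> e2 e1 lt12.
have {}e1 : (u1 ^ 2 + u3 ^ 2 = 2 * u2 ^ 2 + 2)%N by lia.
have {}e2 : (u2 ^ 2 + u4 ^ 2 = 2 * u3 ^ 2 + 2)%N by lia.
have {}lt12 : (u1 < u2)%N by rewrite -ltn_sqr; lia.
have sq4 n : exists m, (n ^ 2 = 4 * m + odd n)%N.
  exists (n./2 * n./2 + n./2 * odd n)%N; rewrite -{1}(odd_double_half n).
  by case: (odd n) => /=; rewrite -mul2n -mulnn; ring.
(* For equal parities, [u3^2 = 2 * u2^2 + 2 - u1^2] would be 2 or 3 modulo 4. *)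
have alt : odd u1 != odd u2.
  have [m1 h1] := sq4 u1; have [m2 h2] := sq4 u2; have [m3 h3] := sq4 u3.
  apply/eqP => par; move: e1; rewrite h1 h2 h3 par.
  by case: (odd u2); case: (odd u3) => /=; lia.
have [h eh] : exists h, u2 = (u1 + 2 * h + 1)%N.
  exists (u2 - u1)./2; have := odd_double_half (u2 - u1).
  by rewrite oddB 1?ltnW // addbC; case: (odd u1) (odd u2) alt => [] [] //=; lia.
(* This is [(u2^2 - u1^2 - 1) / 2] written in [u1] and [h]; [p] is the factored form of
   [(s^2 - u1^2) / 4]. *)
pose s := (u1 + 2 * (h * (u1 + h.+1)))%N.
pose p := (h * (u1 + h) * h.+1 * (u1 + h.+1))%N.
have q1 : (s ^ 2 = u1 ^ 2 + 4 * p)%N by rewrite /s /p; ring.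
have q2 : (s.+1 ^ 2 = u2 ^ 2 + 4 * p)%N by rewrite eh /s /p; ring.
(* The squares of consecutive integers also have second difference 2, so the last two equations
   follow from the first two. *)
exists s, p; split=> //; move: q1 q2 e1 e2; rewrite -!mulnn; lia.
Qed.

(** * Conclusion, with the case of product zero treated apart *)

Theorem theorem1p6 (u1 u2 u3 u4 : nat)
    (hu : buchi_tuple [tuple u1; u2; u3; u4]) :
  exists (s0 s1 s2 s3 s4 s5 s6 s7 s8 s9 s10 s11 s12 s13 s14 s15 : nat)
         (beta1 beta2 delta : nat),
    [/\ beta1 = 1%N \/ beta1 = 2%N,
        beta2 = 1%N \/ beta2 = 2%N,
        delta = 1%N \/ delta = 3%N
      & buchi_relations
          s0%:R s1%:R s2%:R s3%:R s4%:R s5%:R s6%:R s7%:R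
          s8%:R s9%:R s10%:R s11%:R s12%:R s13%:R s14%:R s15%:R
          beta1%:R beta2%:R delta%:R] /\
    let x1 := (s0 * s2 * s4 * s6 * s8 * s10 * s12 * s14)%N in
    let y1 := (s1 * s3 * s5 * s7 * s9 * s11 * s13 * s15)%N in
    let x2 := (s0 * s1 * s4 * s5 * s8 * s9 * s12 * s13)%N in
    let y2 := (s2 * s3 * s6 * s7 * s10 * s11 * s14 * s15)%N in
    let x3 := (s0 * s1 * s2 * s3 * s8 * s9 * s10 * s11)%N in
    let y3 := (s4 * s5 * s6 * s7 * s12 * s13 * s14 * s15)%N in
    let x4 := (s0 * s1 * s2 * s3 * s4 * s5 * s6 * s7)%N in
    let y4 := (s8 * s9 * s10 * s11 * s12 * s13 * s14 * s15)%N in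
    [/\ u1%:Z = x1%:Z - y1%:Z,
        u2%:Z = x2%:Z - y2%:Z,
        u3%:Z = x3%:Z - y3%:Z
      & u4%:Z = x4%:Z - y4%:Z].
Proof.
have [pos _ _] := hu.
have u1p : (0 < u1)%N := pos 0%N isT.
have u2p : (0 < u2)%N := pos 1%N isT.
have u3p : (0 < u3)%N := pos 2%N isT.
have u4p : (0 < u4)%N := pos 3%N isT.
have [s [p [q1 q2 q3 q4]]] := buchi_quadruple_factors hu.
case: p => [|p] in q1 q2 q3 q4.
  (* Here u_k = u_1 + k - 1 and all y_k vanish. *)
  have ss v t : (t ^ 2 = v ^ 2 + 4 * 0)%N -> v = t.
    by rewrite muln0 addn0 => /eqP; rewrite eqn_sqr => /eqP.
  have {}q1 := ss _ _ q1; have {}q2 := ss _ _ q2.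
  have {}q3 := ss _ _ q3; have {}q4 := ss _ _ q4.
  (* [s15] is a factor of every [y_k], while [s14], [s13], [s11], [s7] are each a factor of a single
     [x_k], for [k = 1, 2, 3, 4]. Then [s10 = 1] requires [beta1 = 2], and [s0 = 1] requires
     [delta = 1]. *)
  exists 1, 1, 1, 1, 1, 1, 1, s.+3, 1, 1, 1, s.+2, 1, s.+1, s, 0, 2, 2, 1.
  split; last by rewrite q1 q2 q3 q4 /=; split; lia.
  split; [by right|by right|by left|].
  have s3n0 : (s%:R + 3 : rat) != 0 by rewrite -(natrD _ s 3) pnatr_eq0 addnS.
  have -> : s.+3%:R = s%:R + 3 :> rat by rewrite -addn3 natrD.
  have -> : s.+2%:R = s%:R + 2 :> rat by rewrite -addn2 natrD.
  have -> : s.+1%:R = s%:R + 1 :> rat by rewrite -addn1 natrD.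
  by split; [|split; split; field].
have [y1 t1 p1] := factors_of_square_gap4 q1.
have [y2 t2 p2] := factors_of_square_gap4 q2.
have [y3 t3 p3] := factors_of_square_gap4 q3.
have [y4 t4 p4] := factors_of_square_gap4 q4.
have bounds u y : (0 < u)%N -> ((u + y) * y = p.+1)%N -> (0 < y < u + y)%N.
  by move=> up; case: y => [|y] e; [rewrite muln0 in e | lia].
have /(_ (bounds _ _ u1p p1) (bounds _ _ u2p p2) (bounds _ _ u3p p3)
        (bounds _ _ u4p p4)) H := @common_factorization
  (u1 + y1) y1 (u2 + y2) y2 (u3 + y3) y3 (u4 + y4) y4.
have [||||||s0 [s1 [s2 [s3 [s4 [s5 [s6 [s7 [s8 [s9 [s10 [s11 [s12 [s13
  [s14 [s15 [beta1 [beta2 [delta [rels [[x1E y1E] [x2E y2E] [x3E y3E]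
  [x4E y4E]]]]]]]]]]]]]]]]]]]]]] := H; try lia.
exists s0, s1, s2, s3, s4, s5, s6, s7, s8, s9, s10, s11, s12, s13, s14, s15.
exists beta1, beta2, delta; split=> //=.
rewrite -x1E -y1E -x2E -y2E -x3E -y3E -x4E -y4E.
by rewrite !PoszD !addrK.
Qed.
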